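(* In the binary random graph affiliation mixture model with $Q=2$ groups, if $\alpha\ne\beta$ then the parameters $\alpha,\beta$ and $\{\pi_1,\pi_2=1-\pi_1\}$ (the latter up to label swapping) are strictly identifiable from the joint distribution of $K_3$; that is, any two parameter values $(\pi_1,\alpha,\beta)$, $(\pi_1',\alpha',\beta')$ with $\alpha\neq\beta$, $\alpha'\ne\beta'$ inducing the same law of $K_3$ satisfy $\alpha=\alpha'$, $\beta=\beta'$, and $\pi_1'\in\{\pi_1,1-\pi_1\}$.
   Context: Random graph mixture model: nodes have i.i.d. latent groups $Z_i\in\{1,\dots,Q\}$ with $\pi_q=\mathbb P(Z_i=q)\in(0,1)$, $\sum_q\pi_q=1$; edge variables $X_{ij}$ ($i<j$) are conditionally independent given all $Z$'s, with law of $X_{ij}$ depending only on $(Z_i,Z_j)$. Binary affiliation model: $X_{ij}\in\{0,1\}$ with $\mathbb P(X_{ij}=1\mid Z_i=q,Z_j=l)=\alpha$ if $q=l$ and $=\beta$ if $q\ne l$. $K_n$ denotes the collection of the $\binom n2$ edge variables among a set of $n$ nodes. *)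

(* Defs.v *)
(* the statement is purely algebraic (finite sums/products of
   probabilities), so we state it over an arbitrary real field R. *)
From HB Require Import structures.
From mathcomp Require Import all_boot all_order all_algebra.
Set Implicit Arguments. Unset Strict Implicit. Unset Printing Implicit Defensive.
Import Order.TTheory GRing.Theory Num.Theory.
Local Open Scope ring_scope.

(* Groups are labelled by 'I_2 (group 1 = ord0, group 2 = the other one). *)

Definition grp_prob {R : pzRingType} (p1 : R) (q : 'I_2) : R :=
  if q == ord0 then p1 else 1 - p1.

Definition aff_conn {R : pzRingType} (a b : R) (q l : 'I_2) : R :=
  if q == l then a else b.

Definition bern {R : pzRingType} (p : R) (x : bool) : R :=
  if x then p else 1 - p.

(* Joint law of K_3 = (X_12, X_13, X_23) in the binary affiliation model with
   Q = 2 groups and parameters (pi_1 = p1, alpha = a, beta = b):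
   P(X_12 = x12, X_13 = x13, X_23 = x23). *)
Definition K3_law {R : pzRingType} (p1 a b : R) (x12 x13 x23 : bool) : R :=
  \sum_(z1 : 'I_2) \sum_(z2 : 'I_2) \sum_(z3 : 'I_2)
    grp_prob p1 z1 * grp_prob p1 z2 * grp_prob p1 z3
    * bern (aff_conn a b z1 z2) x12
    * bern (aff_conn a b z1 z3) x13
    * bern (aff_conn a b z2 z3) x23.

(* Main.v *)
Require Import Defs.
From HB Require Import structures.
From mathcomp Require Import all_boot all_order all_algebra.
From mathcomp Require Import ring lra.
Set Implicit Arguments. Unset Strict Implicit. Unset Printing Implicit Defensive.
Import Order.TTheory GRing.Theory Num.Theory.
Local Open Scope ring_scope.

(* With u := pi_1 pi_2 and d := alpha - beta, the first three moments of K_3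
   are m1 = alpha - 2ud, m2 = m1^2 + v and m3 = m1^3 + 3 m1 v + 6vw + 8w^3,
   where w := ud and v := d^2 u (1 - 4u) >= 0.  So m1 and m2 determine
   v, and since w |-> 6vw + 8w^3 is injective for v >= 0, m3 determines w.
   Then d = (v + 4w^2) / w, u = w / d and alpha = m1 + 2w; finally
   pi_1 pi_2 = u leaves only pi_1 and 1 - pi_1. *)

Lemma cubic_shift_inj (R : realDomainType) (v w w' : R) : 0 <= v ->
  6 * v * w + 8 * w ^+ 3 = 6 * v * w' + 8 * w' ^+ 3 -> w = w'.
Proof.
move=> v_ge0 E.
have: (w - w') * (6 * v + 2 * ((2 * w + w') ^+ 2 + 3 * w' ^+ 2)) = 0.
  by rewrite -[0](subrr (6 * v * w' + 8 * w' ^+ 3)) -{1}E; ring.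
move/eqP; rewrite mulf_eq0 subr_eq0 => /orP[/eqP //| /eqP F].
have sq_w'_0 : w' ^+ 2 = 0.
  by have := sqr_ge0 (2 * w + w'); have := sqr_ge0 w'; lra.
have sq_sum_0 : (2 * w + w') ^+ 2 = 0 by have := sqr_ge0 (2 * w + w'); lra.
move/eqP: sq_w'_0; rewrite sqrf_eq0 => /eqP w'0.
by move/eqP: sq_sum_0; rewrite sqrf_eq0 w'0 addr0 mulf_eq0 pnatr_eq0 => /eqP.
Qed.

Lemma mul_subr1_inj (R : idomainType) (p p' : R) :
  p' * (1 - p') = p * (1 - p) -> p' = p \/ p' = 1 - p.
Proof.
move=> E.
have: (p' - p) * (p' - (1 - p)) = p * (1 - p) - p' * (1 - p') by ring.
by rewrite E subrr => /eqP; rewrite mulf_eq0 !subr_eq0 => /orP[] /eqP; [left | right].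
Qed.

Lemma triangle_moment_expand (R : comPzRingType) (x y z : R) :
  (1 - 3 * x) * y ^+ 3 + 3 * x * y * z ^+ 2 =
  let w := x * (y - z) in let v := (y - z) ^+ 2 * x * (1 - 4 * x) in
  (y - 2 * w) ^+ 3 + 3 * (y - 2 * w) * v + 6 * v * w + 8 * w ^+ 3.
Proof. by cbv zeta; ring. Qed.

Section AffiliationMoments.

Variables (R : realFieldType) (u a b u' a' b' : R).
Hypotheses (u_ge0 : 0 <= u) (u_le : 4 * u <= 1) (u'_neq0 : u' != 0)
  (a'_neq_b' : a' != b').

Lemma affiliation_moments_inj :
  a - 2 * u * (a - b) = a' - 2 * u' * (a' - b') ->
  (a - b) ^+ 2 * u * (1 - 4 * u) = (a' - b') ^+ 2 * u' * (1 - 4 * u') ->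
  (1 - 3 * u) * a ^+ 3 + 3 * u * a * b ^+ 2 =
    (1 - 3 * u') * a' ^+ 3 + 3 * u' * a' * b' ^+ 2 ->
  [/\ a = a', b = b' & u = u'].
Proof.
rewrite !triangle_moment_expand /=.
set w := u * (a - b); set w' := u' * (a' - b').
set v := (a - b) ^+ 2 * _ * _; set v' := (a' - b') ^+ 2 * _ * _.
have -> : a - 2 * u * (a - b) = a - 2 * w by rewrite /w; ring.
have -> : a' - 2 * u' * (a' - b') = a' - 2 * w' by rewrite /w'; ring.
move=> E1 Ev; rewrite E1 Ev -!addrA => /addrI /addrI E3.
have v'_ge0 : 0 <= v'.
  rewrite -Ev /v; apply: mulr_ge0; last by rewrite subr_ge0.
  by rewrite mulr_ge0 ?sqr_ge0.
have Ew : w = w' by exact: cubic_shift_inj v'_ge0 E3.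
have d'_neq0 : a' - b' != 0 by rewrite subr_eq0.
have w'_neq0 : w' != 0 by rewrite mulf_neq0.
have Ed : a - b = a' - b'.
  apply: (mulfI w'_neq0); rewrite -{1}Ew.
  have -> : w * (a - b) = v + 4 * w ^+ 2 by rewrite /w /v; ring.
  by rewrite Ev Ew /w' /v'; ring.
have Ea : a = a' by move: E1; rewrite Ew => /addIr.
split=> //; first by move: Ed; rewrite Ea => /addrI /oppr_inj.
by apply: (mulIf d'_neq0); rewrite -{1}Ed; exact: Ew.
Qed.

End AffiliationMoments.

Section K3Moments.

Variables (R : comPzRingType) (p a b : R).
Let u := p * (1 - p).

Lemma K3_law_edge_moment :
  \sum_(x13 : bool) \sum_(x23 : bool) K3_law p a b true x13 x23 =
  a - 2 * u * (a - b).
Proof.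
rewrite !big_bool /K3_law !big_ord_recl !big_ord0 /=.
by rewrite /grp_prob /aff_conn /bern /u /=; ring.
Qed.

Lemma K3_law_cherry_moment :
  \sum_(x23 : bool) K3_law p a b true true x23 =
  (a - 2 * u * (a - b)) ^+ 2 + (a - b) ^+ 2 * u * (1 - 4 * u).
Proof.
rewrite !big_bool /K3_law !big_ord_recl !big_ord0 /=.
by rewrite /grp_prob /aff_conn /bern /u /=; ring.
Qed.

Lemma K3_law_triangle_moment :
  K3_law p a b true true true = (1 - 3 * u) * a ^+ 3 + 3 * u * a * b ^+ 2.
Proof.
rewrite /K3_law !big_ord_recl !big_ord0 /=.
by rewrite /grp_prob /aff_conn /bern /u /=; ring.
Qed.

End K3Moments.

Theorem corollary1 (R : realFieldType) (p1 a b p1' a' b' : R) :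
  0 < p1 < 1 -> 0 <= a <= 1 -> 0 <= b <= 1 ->
  0 < p1' < 1 -> 0 <= a' <= 1 -> 0 <= b' <= 1 ->
  a != b -> a' != b' ->
  (forall x12 x13 x23 : bool,
      K3_law p1 a b x12 x13 x23 = K3_law p1' a' b' x12 x13 x23) ->
  [/\ a = a', b = b' & (p1' = p1 \/ p1' = 1 - p1)].
Proof.
move=> /andP[p1_gt0 p1_lt1] _ _ /andP[p1'_gt0 p1'_lt1] _ _ _ a'_neq_b' law_eq.
set u := p1 * (1 - p1); set u' := p1' * (1 - p1').
have E1 : a - 2 * u * (a - b) = a' - 2 * u' * (a' - b').
  rewrite -!K3_law_edge_moment.
  by apply: eq_bigr => x13 _; apply: eq_bigr => x23 _; exact: law_eq.
have E2 : (a - b) ^+ 2 * u * (1 - 4 * u) = (a' - b') ^+ 2 * u' * (1 - 4 * u').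
  apply: (@addrI _ ((a - 2 * u * (a - b)) ^+ 2)); rewrite {2}E1.
  by rewrite -!K3_law_cherry_moment; apply: eq_bigr => x23 _; exact: law_eq.
have E3 : (1 - 3 * u) * a ^+ 3 + 3 * u * a * b ^+ 2 =
    (1 - 3 * u') * a' ^+ 3 + 3 * u' * a' * b' ^+ 2.
  by rewrite -!K3_law_triangle_moment law_eq.
have u_ge0 : 0 <= u by rewrite mulr_ge0 ?subr_ge0 ?ltW.
have u_le : 4 * u <= 1.
  rewrite -subr_ge0.
  have -> : 1 - 4 * u = (1 - 2 * p1) ^+ 2 by rewrite /u; ring.
  exact: sqr_ge0.
have u'_neq0 : u' != 0 by rewrite mulf_neq0 ?subr_eq0 ?gt_eqF ?lt_eqF.
have [-> -> Eu] := affiliation_moments_inj u_ge0 u_le u'_neq0 a'_neq_b' E1 E2 E3.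
by split=> //; apply: mul_subr1_inj; rewrite -/u -/u' Eu.
Qed.
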